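(* There exists a polynomial $Q\in R$ such that $Q-t_{(5)}t_{(-5)}\in\ker(\Pi)$, and in particular one may take $$\begin{aligned} Q=&\,9-6t_{(1)}t_{(-1)}-6t_{(2)}t_{(-2)}-6t_{(3)}t_{(-3)}-6t_{(4)}t_{(-4)}+t_{(1)}^3+t_{(2)}^3+t_{(3)}^3+t_{(4)}^3\\ &+t_{(-1)}^3+t_{(-2)}^3+t_{(-3)}^3+t_{(-4)}^3-3t_{(-4)}t_{(-3)}t_{(-1)}-3t_{(4)}t_{(3)}t_{(1)}\\ &-3t_{(-4)}t_{(2)}t_{(3)}-3t_{(4)}t_{(-2)}t_{(-3)}+3t_{(-4)}t_{(-2)}t_{(1)}+3t_{(4)}t_{(2)}t_{(-1)}\\ &+3t_{(1)}t_{(2)}t_{(-3)}+3t_{(-1)}t_{(-2)}t_{(3)}+t_{(-2)}t_{(-1)}t_{(2)}t_{(1)}+t_{(-3)}t_{(-2)}t_{(3)}t_{(2)}\\ &+t_{(-4)}t_{(-1)}t_{(4)}t_{(1)}+t_{(-4)}t_{(-2)}t_{(4)}t_{(2)}+t_{(-3)}t_{(-1)}t_{(3)}t_{(1)}+t_{(-3)}t_{(-4)}t_{(3)}t_{(4)}\\ &+t_{(-4)}^2t_{(-3)}t_{(-2)}+t_{(4)}^2t_{(3)}t_{(2)}+t_{(-1)}^2t_{(-2)}t_{(-4)}+t_{(1)}^2t_{(2)}t_{(4)}\\ &+t_{(1)}t_{(-2)}^2t_{(-3)}+t_{(-1)}t_{(2)}^2t_{(3)}+t_{(-4)}t_{(-3)}t_{(1)}^2+t_{(4)}t_{(3)}t_{(-1)}^2\\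 &+t_{(-4)}t_{(2)}t_{(-3)}^2+t_{(4)}t_{(-2)}t_{(3)}^2+t_{(-1)}^2t_{(-3)}t_{(2)}+t_{(1)}^2t_{(3)}t_{(-2)}\\ &+t_{(-4)}t_{(1)}t_{(2)}^2+t_{(4)}t_{(-1)}t_{(-2)}^2+t_{(-4)}t_{(3)}t_{(-2)}^2+t_{(4)}t_{(-3)}t_{(2)}^2\\ &+t_{(1)}t_{(3)}t_{(-4)}^2+t_{(-1)}t_{(-3)}t_{(4)}^2+t_{(-1)}t_{(-4)}t_{(3)}^2+t_{(1)}t_{(4)}t_{(-3)}^2-2t_{(-3)}^2t_{(-2)}t_{(-1)}\\ &-2t_{(3)}^2t_{(2)}t_{(1)}-2t_{(-4)}^2t_{(-1)}t_{(2)}-2t_{(4)}^2t_{(1)}t_{(-2)}+t_{(-1)}^2t_{(-2)}^2t_{(-3)}+t_{(1)}^2t_{(2)}^2t_{(3)}\\ &+t_{(-4)}t_{(-1)}^2t_{(2)}^2+t_{(4)}t_{(1)}^2t_{(-2)}^2-t_{(-4)}t_{(-2)}^2t_{(2)}t_{(1)}-t_{(4)}t_{(2)}^2t_{(-2)}t_{(-1)}\\ &-t_{(-3)}t_{(1)}^2t_{(-1)}t_{(2)}-t_{(3)}t_{(-1)}^2t_{(1)}t_{(-2)}-t_{(-3)}t_{(2)}^2t_{(-2)}t_{(1)}-t_{(3)}t_{(-2)}^2t_{(2)}t_{(-1)}\\ &-t_{(-4)}t_{(-2)}t_{(-1)}t_{(1)}^2-t_{(4)}t_{(2)}t_{(1)}t_{(-1)}^2-t_{(-1)}t_{(-2)}^3t_{(1)}-t_{(-1)}t_{(2)}^3t_{(1)}\\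 &-t_{(-1)}^3t_{(-2)}t_{(2)}-t_{(1)}^3t_{(-2)}t_{(2)}-t_{(-4)}t_{(-3)}t_{(-2)}t_{(-1)}t_{(2)}-t_{(4)}t_{(3)}t_{(2)}t_{(1)}t_{(-2)}\\ &-t_{(-1)}t_{(1)}t_{(2)}t_{(-4)}t_{(3)}-t_{(-1)}t_{(1)}t_{(-2)}t_{(4)}t_{(-3)}+t_{(-2)}t_{(-1)}^2t_{(1)}^2t_{(2)}+t_{(-1)}t_{(-2)}^2t_{(2)}^2t_{(1)}. \end{aligned}$$
   Context: Let $G=\mathrm{SL}(3,\mathbb{C})$ act on $G\times G$ by simultaneous conjugation, and let $\mathbb{C}[G\times G]^G$ be the ring of invariant regular functions. Write $\mathbf{x}_1,\mathbf{x}_2$ for the two coordinate (generic) matrices of $G\times G$; for a word in $\mathbf{x}_1^{\pm1},\mathbf{x}_2^{\pm1}$ its trace is an element of $\mathbb{C}[G\times G]^G$. Let $R=\mathbb{C}[t_{(\pm1)},t_{(\pm2)},t_{(\pm3)},t_{(\pm4)}]$ be the polynomial ring in eight indeterminates and $R[t_{(5)},t_{(-5)}]$ the polynomial ring in two further indeterminates. Define the $\mathbb{C}$-algebra homomorphism $\Pi:R[t_{(5)},t_{(-5)}]\to\mathbb{C}[G\times G]^G$ by $t_{(1)}\mapsto\mathrm{tr}(\mathbf{x}_1)$, $t_{(-1)}\mapsto\mathrm{tr}(\mathbf{x}_1^{-1})$, $t_{(2)}\mapsto\mathrm{tr}(\mathbf{x}_2)$, $t_{(-2)}\mapsto\mathrm{tr}(\mathbf{x}_2^{-1})$,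 $t_{(3)}\mapsto\mathrm{tr}(\mathbf{x}_1\mathbf{x}_2)$, $t_{(-3)}\mapsto\mathrm{tr}(\mathbf{x}_1^{-1}\mathbf{x}_2^{-1})$, $t_{(4)}\mapsto\mathrm{tr}(\mathbf{x}_1\mathbf{x}_2^{-1})$, $t_{(-4)}\mapsto\mathrm{tr}(\mathbf{x}_1^{-1}\mathbf{x}_2)$, $t_{(5)}\mapsto\mathrm{tr}(\mathbf{x}_1\mathbf{x}_2\mathbf{x}_1^{-1}\mathbf{x}_2^{-1})$, $t_{(-5)}\mapsto\mathrm{tr}(\mathbf{x}_2\mathbf{x}_1\mathbf{x}_2^{-1}\mathbf{x}_1^{-1})$. *)

(* Defs.v *)
From HB Require Import structures.
From mathcomp Require Import all_boot all_order all_algebra.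
From mathcomp Require Import boolp classical_sets functions reals.
From mathcomp Require Import complex mpoly.

Set Implicit Arguments.
Unset Strict Implicit.
Unset Printing Implicit Defensive.

Import GRing.Theory.
Local Open Scope ring_scope.

(* R is a complete ordered field, so R[i] is the field of complex numbers. *)
Record SL3 (R : realType) :=
  MkSL3 { slmx :> 'M[R[i]]_3; _ : \det slmx == 1 }.

HB.instance Definition _ (R : realType) := [isSub for @slmx R].
HB.instance Definition _ (R : realType) := [Choice of SL3 R by <:].

Section SL3Group.
Variable R : realType.
Implicit Types x y z : SL3 R.

Fact det_SL3 x : \det (slmx x) = 1.
Proof. by case: x => A /= /eqP. Qed.

Fact unitmx_SL3 x : slmx x \in unitmx.
Proof. by rewrite unitmxE det_SL3 unitr1. Qed.

Fact SL3_one_subproof : \det (1%:M : 'M[R[i]]_3) == 1.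
Proof. by rewrite det1. Qed.

Fact SL3_mul_subproof x y : \det (slmx x *m slmx y) == 1.
Proof. by rewrite det_mulmx !det_SL3 mulr1. Qed.

Fact SL3_inv_subproof x : \det (invmx (slmx x)) == 1.
Proof. by rewrite det_inv det_SL3 invr1. Qed.

Definition SL3_one : SL3 R := MkSL3 SL3_one_subproof.
Definition SL3_mul x y : SL3 R := MkSL3 (SL3_mul_subproof x y).
Definition SL3_inv x : SL3 R := MkSL3 (SL3_inv_subproof x).

Fact SL3_mulA : associative SL3_mul.
Proof. by move=> x y z; apply/val_inj; rewrite /= mulmxA. Qed.
Fact SL3_mul1 : left_id SL3_one SL3_mul.
Proof. by move=> x; apply/val_inj; rewrite /= mul1mx. Qed.
Fact SL3_mulr1 : right_id SL3_one SL3_mul.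
Proof. by move=> x; apply/val_inj; rewrite /= mulmx1. Qed.
Fact SL3_mulV : left_inverse SL3_one SL3_inv SL3_mul.
Proof. by move=> x; apply/val_inj; rewrite /= mulVmx ?unitmx_SL3. Qed.
Fact SL3_mulrV : right_inverse SL3_one SL3_inv SL3_mul.
Proof. by move=> x; apply/val_inj; rewrite /= mulmxV ?unitmx_SL3. Qed.

HB.instance Definition _ := isGroup.Build (SL3 R)
  SL3_mulA SL3_mul1 SL3_mulr1 SL3_mulV SL3_mulrV.
HB.instance Definition _ := isPointed.Build (SL3 R) SL3_one.

End SL3Group.

Definition SL3pair (R : realType) : pointedType := (SL3 R * SL3 R)%type.

Definition conj_act (R : realType) (h : SL3 R) (g : SL3pair R) : SL3pair R :=
  (h * g.1 * h^-1, h * g.2 * h^-1)%g.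

(* The 18 matrix entries of a pair, i.e. its coordinates in affine space. *)
Definition coords (R : realType) (g : SL3pair R) (i : 'I_(3 * 3 + 3 * 3)) :
  R[i] := row_mx (mxvec g.1) (mxvec g.2) 0 i.

Definition regular (R : realType) (f : SL3pair R -> R[i]) : Prop :=
  exists p : {mpoly R[i][3 * 3 + 3 * 3]}, forall g, f g = p.@[coords g].

Definition invariant (R : realType) (f : SL3pair R -> R[i]) : Prop :=
  forall h g, f (conj_act h g) = f g.

Definition inv_regular (R : realType) : pred (SL3pair R -> R[i]) :=
  fun f => `[< regular f /\ invariant f >].

(* The ring C[G x G]^G, as a ring of functions with pointwise operations. *)
Record invring (R : realType) := MkInvring
  { invring_fun :> SL3pair R -> R[i]; _ : invring_fun \in @inv_regular R }.

HB.instance Definition _ (R : realType) := [isSub for @invring_fun R].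
HB.instance Definition _ (R : realType) := [Choice of invring R by <:].

Section InvRing.
Variable R : realType.
Implicit Types (f : SL3pair R -> R[i]) (c : R[i]) (F : invring R).

Fact inv_regularP f : reflect (regular f /\ invariant f) (f \in @inv_regular R).
Proof. exact: asboolP. Qed.

Fact inv_regular_cst c : (fun=> c) \in @inv_regular R.
Proof.
by apply/inv_regularP; split=> [|//]; exists c%:MP => g; rewrite mevalC.
Qed.

Fact inv_regular_subring : subring_closed (@inv_regular R).
Proof.
split=> [|f1 f2|f1 f2]; first exact: (inv_regular_cst 1).
- move=> /inv_regularP[[p1 e1] i1] /inv_regularP[[p2 e2] i2].
  apply/inv_regularP; split; first by exists (p1 - p2) => g; rewrite mevalB -e1 -e2.
  by move=> h g; rewrite /= opprfctE addrfctE i1 i2.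
- move=> /inv_regularP[[p1 e1] i1] /inv_regularP[[p2 e2] i2].
  apply/inv_regularP; split; first by exists (p1 * p2) => g; rewrite mevalM -e1 -e2.
  by move=> h g; rewrite /= mulrfctE i1 i2.
Qed.

HB.instance Definition _ := GRing.SubChoice_isSubComNzRing.Build
  (SL3pair R -> R[i]) (@inv_regular R) (invring R) inv_regular_subring.

Definition invring_cst c : invring R := MkInvring (inv_regular_cst c).
Definition invring_scale c F : invring R := invring_cst c * F.

Fact invring_scaleA c d F :
  invring_scale c (invring_scale d F) = invring_scale (c * d) F.
Proof. by rewrite /invring_scale mulrA; congr (_ * _); apply/val_inj. Qed.
Fact invring_scale1 : left_id 1 invring_scale.
Proof. by move=> F; rewrite -[RHS]mul1r; congr (_ * _); apply/val_inj. Qed.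
Fact invring_scaleDr : right_distributive invring_scale +%R.
Proof. by move=> c F G; apply: mulrDr. Qed.
Fact invring_scaleDl F : {morph invring_scale^~ F : c d / c + d}.
Proof.
by move=> c d; rewrite /invring_scale -mulrDl; congr (_ * _); apply/val_inj.
Qed.

HB.instance Definition _ := GRing.Zmodule_isLmodule.Build R[i] (invring R)
  invring_scaleA invring_scale1 invring_scaleDr invring_scaleDl.

Fact invring_scaleAl c F G : c *: (F * G) = c *: F * G.
Proof. exact: mulrA. Qed.

HB.instance Definition _ :=
  GRing.Lmodule_isLalgebra.Build R[i] (invring R) invring_scaleAl.
HB.instance Definition _ := GRing.Lalgebra_isComAlgebra.Build R[i] (invring R).

Fact invring_scaleE c F g : (c *: F) g = c * F g.
Proof. by []. Qed.

End InvRing.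

Inductive letter := X1 | X1V | X2 | X2V.
Definition word := seq letter.

Section Traces.
Variable R : realType.

Definition eval_letter (g : SL3pair R) (l : letter) : SL3 R :=
  match l with
  | X1 => g.1 | X1V => (g.1^-1)%g | X2 => g.2 | X2V => (g.2^-1)%g
  end.

Fixpoint eval_word (g : SL3pair R) (w : word) : SL3 R :=
  if w is l :: w' then (eval_letter g l * eval_word g w')%g else 1%g.

Local Notation P := {mpoly R[i][3 * 3 + 3 * 3]}.

Fact eval_wordJ (h : SL3 R) (g : SL3pair R) (w : word) :
  eval_word (conj_act h g) w = (h * eval_word g w * h^-1)%g.
Proof.
elim: w => [|l w IHw] /=; first by rewrite mulg1 mulgV.
have -> : eval_letter (conj_act h g) l = (h * eval_letter g l * h^-1)%g.
  by case: l => //=; rewrite !invgM invgK !mulgA.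
by rewrite IHw -!mulgA mulKg.
Qed.

Fact eval_letter_poly (l : letter) :
  exists M : 'M[P]_3, forall g,
    slmx (eval_letter g l) = map_mx (meval (coords g)) M.
Proof.
pose M1 : 'M[P]_3 := \matrix_(i, j) 'X_(lshift (3 * 3) (mxvec_index i j)).
pose M2 : 'M[P]_3 := \matrix_(i, j) 'X_(rshift (3 * 3) (mxvec_index i j)).
have E1 g : slmx g.1 = map_mx (meval (coords g)) M1.
  by apply/matrixP=> i j; rewrite !mxE mevalXU /coords row_mxEl mxvecE.
have E2 g : slmx g.2 = map_mx (meval (coords g)) M2.
  by apply/matrixP=> i j; rewrite !mxE mevalXU /coords row_mxEr mxvecE.
have invE (x : SL3 R) : slmx x^-1%g = \adj (slmx x).
  by rewrite /= /invmx unitmx_SL3 det_SL3 invr1 scale1r.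
case: l.
- by exists M1 => g; rewrite -E1.
- by exists (\adj M1) => g; rewrite /eval_letter invE E1 map_mx_adj.
- by exists M2 => g; rewrite -E2.
- by exists (\adj M2) => g; rewrite /eval_letter invE E2 map_mx_adj.
Qed.

Fact eval_word_poly (w : word) :
  exists M : 'M[P]_3, forall g,
    slmx (eval_word g w) = map_mx (meval (coords g)) M.
Proof.
elim: w => [|l w [M eM]]; first by exists 1%:M => g; rewrite map_mx1.
have [N eN] := eval_letter_poly l.
by exists (N *m M) => g; rewrite map_mxM -eN -eM.
Qed.

Fact trace_word_subproof (w : word) :
  (fun g => \tr (slmx (eval_word g w))) \in @inv_regular R.
Proof.
apply/inv_regularP; split=> [|h g].
  by have [M eM] := eval_word_poly w; exists (\tr M) => g; rewrite eM trace_map_mx.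
by rewrite eval_wordJ /= mxtrace_mulC mulmxA mulVmx ?unitmx_SL3 ?mul1mx.
Qed.

Definition trace_word (w : word) : invring R :=
  MkInvring (trace_word_subproof w).

End Traces.

(* The indeterminates t_(k) and t_(-k) are written tk and tmk. *)
Notation polyR R := {mpoly R[i][8]}.
Notation polyR5 R := {mpoly (polyR R)[2]}.

Definition t1 (R : realType) : polyR R := 'X_(@Ordinal 8 0 isT).
Definition t2 (R : realType) : polyR R := 'X_(@Ordinal 8 1 isT).
Definition t3 (R : realType) : polyR R := 'X_(@Ordinal 8 2 isT).
Definition t4 (R : realType) : polyR R := 'X_(@Ordinal 8 3 isT).
Definition tm1 (R : realType) : polyR R := 'X_(@Ordinal 8 4 isT).
Definition tm2 (R : realType) : polyR R := 'X_(@Ordinal 8 5 isT).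
Definition tm3 (R : realType) : polyR R := 'X_(@Ordinal 8 6 isT).
Definition tm4 (R : realType) : polyR R := 'X_(@Ordinal 8 7 isT).
Definition t5 (R : realType) : polyR5 R := 'X_(@Ordinal 2 0 isT).
Definition tm5 (R : realType) : polyR5 R := 'X_(@Ordinal 2 1 isT).

Definition PiR_val (R : realType) (k : 'I_8) : invring R :=
  trace_word R (nth [::]
    [:: [:: X1]; [:: X2]; [:: X1; X2]; [:: X1; X2V];
        [:: X1V]; [:: X2V]; [:: X1V; X2V]; [:: X1V; X2]] k).

Definition Pi5_val (R : realType) (k : 'I_2) : invring R :=
  trace_word R (nth [::]
    [:: [:: X1; X2; X1V; X2V]; [:: X2; X1; X2V; X1V]] k).

Definition PiR (R : realType) : {rmorphism polyR R -> invring R} :=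
  mmap (in_alg (invring R)) (@PiR_val R).

Definition Pi (R : realType) : {rmorphism polyR5 R -> invring R} :=
  mmap (@PiR R) (@Pi5_val R).

(* polyR5 R carries no canonical R[i]-algebra structure, so that Pi is only
   bundled as a ring morphism; it also preserves the scalars. *)
Fact Pi_scalar (R : realType) (c : R[i]) : Pi R (c%:MP)%:MP = c%:A.
Proof. by rewrite /= mmapC /= mmapC. Qed.

(* Main.v *)
Require Import Defs.
From HB Require Import structures.
From mathcomp Require Import all_boot all_order all_algebra.
From mathcomp Require Import boolp classical_sets functions reals.
From mathcomp Require Import complex mpoly.
From mathcomp Require Import ring.

Set Implicit Arguments.
Unset Strict Implicit.
Unset Printing Implicit Defensive.

Import GRing.Theory.
Local Open Scope ring_scope.

(** The identity comes from a polynomial identity in the entries of two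
    arbitrary 3 x 3 matrices [x] and [y] over any commutative ring.  Replace
    the inverses by adjugates: the product of the traces of [x y adj(x) adj(y)]
    and [y x adj(y) adj(x)] is homogeneous of degree 6 in the entries of [x] and
    in those of [y], while each monomial of [Q] has a degree in either set of
    entries that is a multiple of 3 and at most 6.  Multiplying each monomial of
    [Q] by the powers of [det x] and [det y] that raise both degrees to 6
    gives a bihomogeneous form [comm_form], and the two sides then agree as
    polynomials in the 18 entries (lemma [tr_comm_mulE]), which the normal form
    of polynomials decides.

    On SL(3) the determinants are 1 and adjugates are inverses.  As elements of
    the invariant ring are functions on pairs, and [Pi] and the evaluation at a
    pair are ring morphisms, the theorem is the instance of this identity at
    each pair of matrices. *)

(** * The homogenized polynomial *)

(** The polynomial [Q], each monomial being multiplied by the powers of [dx] and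
    [dy] that make it of degree 6 in both gradings, where [dx], [dy] stand for
    the determinants, [t1], ..., [t4] for the traces of [x], [y], [xy],
    [x adj(y)], and [tm1], ..., [tm4] for those of [adj(x)], [adj(y)],
    [adj(x) adj(y)], [adj(x) y]. *)
Definition comm_form (K : comNzRingType)
    (dx dy t1 t2 t3 t4 tm1 tm2 tm3 tm4 : K) : K :=
    9 * dx ^+ 2 * dy ^+ 2 - 6 * t1 * tm1 * dx * dy ^+ 2
    - 6 * t2 * tm2 * dx ^+ 2 * dy - 6 * t3 * tm3 * dx * dy
    - 6 * t4 * tm4 * dx * dy + t1 ^+ 3 * dx * dy ^+ 2 + t2 ^+ 3 * dx ^+ 2 * dy
    + t3 ^+ 3 * dx * dy + t4 ^+ 3 * dx + tm1 ^+ 3 * dy ^+ 2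
    + tm2 ^+ 3 * dx ^+ 2 + tm3 ^+ 3 + tm4 ^+ 3 * dy - 3 * tm4 * tm3 * tm1 * dy
    - 3 * t4 * t3 * t1 * dx * dy - 3 * tm4 * t2 * t3 * dx * dy
    - 3 * t4 * tm2 * tm3 * dx + 3 * tm4 * tm2 * t1 * dx * dy
    + 3 * t4 * t2 * tm1 * dx * dy + 3 * t1 * t2 * tm3 * dx * dy
    + 3 * tm1 * tm2 * t3 * dx * dy + tm2 * tm1 * t2 * t1 * dx * dy
    + tm3 * tm2 * t3 * t2 * dx + tm4 * tm1 * t4 * t1 * dy
    + tm4 * tm2 * t4 * t2 * dx + tm3 * tm1 * t3 * t1 * dy + tm3 * tm4 * t3 * t4
    + tm4 ^+ 2 * tm3 * tm2 + t4 ^+ 2 * t3 * t2 * dx + tm1 ^+ 2 * tm2 * tm4 * dy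
    + t1 ^+ 2 * t2 * t4 * dx * dy + t1 * tm2 ^+ 2 * tm3 * dx
    + tm1 * t2 ^+ 2 * t3 * dx * dy + tm4 * tm3 * t1 ^+ 2 * dy
    + t4 * t3 * tm1 ^+ 2 * dy + tm4 * t2 * tm3 ^+ 2 + t4 * tm2 * t3 ^+ 2 * dx
    + tm1 ^+ 2 * tm3 * t2 * dy + t1 ^+ 2 * t3 * tm2 * dx * dy
    + tm4 * t1 * t2 ^+ 2 * dx * dy + t4 * tm1 * tm2 ^+ 2 * dx
    + tm4 * t3 * tm2 ^+ 2 * dx + t4 * tm3 * t2 ^+ 2 * dx
    + t1 * t3 * tm4 ^+ 2 * dy + tm1 * tm3 * t4 ^+ 2 + tm1 * tm4 * t3 ^+ 2 * dy
    + t1 * t4 * tm3 ^+ 2 - 2 * tm3 ^+ 2 * tm2 * tm1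
    - 2 * t3 ^+ 2 * t2 * t1 * dx * dy - 2 * tm4 ^+ 2 * tm1 * t2 * dy
    - 2 * t4 ^+ 2 * t1 * tm2 * dx + tm1 ^+ 2 * tm2 ^+ 2 * tm3
    + t1 ^+ 2 * t2 ^+ 2 * t3 * dx * dy + tm4 * tm1 ^+ 2 * t2 ^+ 2 * dy
    + t4 * t1 ^+ 2 * tm2 ^+ 2 * dx - tm4 * tm2 ^+ 2 * t2 * t1 * dx
    - t4 * t2 ^+ 2 * tm2 * tm1 * dx - tm3 * t1 ^+ 2 * tm1 * t2 * dy
    - t3 * tm1 ^+ 2 * t1 * tm2 * dy - tm3 * t2 ^+ 2 * tm2 * t1 * dx
    - t3 * tm2 ^+ 2 * t2 * tm1 * dx - tm4 * tm2 * tm1 * t1 ^+ 2 * dy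
    - t4 * t2 * t1 * tm1 ^+ 2 * dy - tm1 * tm2 ^+ 3 * t1 * dx
    - tm1 * t2 ^+ 3 * t1 * dx * dy - tm1 ^+ 3 * tm2 * t2 * dy
    - t1 ^+ 3 * tm2 * t2 * dx * dy - tm4 * tm3 * tm2 * tm1 * t2
    - t4 * t3 * t2 * t1 * tm2 * dx - tm1 * t1 * t2 * tm4 * t3 * dy
    - tm1 * t1 * tm2 * t4 * tm3 + tm2 * tm1 ^+ 2 * t1 ^+ 2 * t2 * dy
    + tm1 * tm2 ^+ 2 * t2 ^+ 2 * t1 * dx.

Lemma rmorph_comm_form (K L : comNzRingType) (f : {rmorphism K -> L})
    (dx dy t1 t2 t3 t4 tm1 tm2 tm3 tm4 : K) :
  f (comm_form dx dy t1 t2 t3 t4 tm1 tm2 tm3 tm4) =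
  comm_form (f dx) (f dy) (f t1) (f t2) (f t3) (f t4)
    (f tm1) (f tm2) (f tm3) (f tm4).
Proof. by rewrite /comm_form; ring. Qed.

(** * Matrices of order 3 given by their entries *)

Section Matrix3.
Variable K : comNzRingType.

(** The 3 x 3 matrix with the given entries, listed by rows. *)
Definition mx3 (a b c d e f g h k : K) : 'M[K]_3 :=
  \matrix_(i, j)
    nth 0 (nth [::] [:: [:: a; b; c]; [:: d; e; f]; [:: g; h; k]] i) j.

(** The indices range over natural numbers, so that a case analysis on them
    yields the nine entries. *)
Lemma matrix3P (A B : 'M[K]_3) :
  (forall i j, (i < 3)%N -> (j < 3)%N ->
    A (inord i) (inord j) = B (inord i) (inord j)) ->
  A = B.
Proof.
by move=> AB; apply/matrixP => i j; rewrite -(inord_val i) -(inord_val j) AB.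
Qed.

Lemma mx3_eta (A : 'M[K]_3) :
  exists a b c d e f g h k, A = mx3 a b c d e f g h k.
Proof.
pose a i j := A (inord i) (inord j).
exists (a 0 0)%N, (a 0 1)%N, (a 0 2)%N, (a 1 0)%N, (a 1 1)%N, (a 1 2)%N,
  (a 2 0)%N, (a 2 1)%N, (a 2 2)%N.
by apply: matrix3P => [] [|[|[|i]]] [|[|[|j]]] // _ _; rewrite mxE !inordK.
Qed.

Lemma mul_mx3 a b c d e f g h k a' b' c' d' e' f' g' h' k' :
  mx3 a b c d e f g h k *m mx3 a' b' c' d' e' f' g' h' k' =
  mx3 (a * a' + b * d' + c * g') (a * b' + b * e' + c * h')
      (a * c' + b * f' + c * k')
      (d * a' + e * d' + f * g') (d * b' + e * e' + f * h')
      (d * c' + e * f' + f * k')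
      (g * a' + h * d' + k * g') (g * b' + h * e' + k * h')
      (g * c' + h * f' + k * k').
Proof.
by apply: matrix3P => [] [|[|[|i]]] [|[|[|j]]] // _ _;
  rewrite !mxE !big_ord_recr big_ord0 /= !mxE !inordK //= add0r.
Qed.

Lemma tr_mx3 a b c d e f g h k : \tr (mx3 a b c d e f g h k) = a + e + k.
Proof. by rewrite /mxtrace !big_ord_recr big_ord0 /= !mxE /= add0r. Qed.

Lemma det_mx2 (A : 'M[K]_2) : \det A = A 0 0 * A 1 1 - A 0 1 * A 1 0.
Proof.
rewrite (expand_det_row _ 0) !big_ord_recl big_ord0 /cofactor !det_mx11 !mxE /=.
have -> : lift 0 0 = 1 :> 'I_2 by apply/val_inj.
have -> : lift 1 0 = 0 :> 'I_2 by apply/val_inj.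
by rewrite /bump /= expr0 expr1; ring.
Qed.

Lemma adj_mx3 a b c d e f g h k :
  \adj (mx3 a b c d e f g h k) =
  mx3 (e * k - f * h) (c * h - b * k) (b * f - c * e)
      (f * g - d * k) (a * k - c * g) (c * d - a * f)
      (d * h - e * g) (b * g - a * h) (a * e - b * d).
Proof.
by apply: matrix3P => [] [|[|[|i]]] [|[|[|j]]] // _ _;
  rewrite !mxE /cofactor det_mx2 !mxE !inordK //=;
  rewrite /bump /= ?inordK //=; ring.
Qed.

Lemma det_mx3 a b c d e f g h k :
  \det (mx3 a b c d e f g h k) =
  a * (e * k - f * h) + b * (f * g - d * k) + c * (d * h - e * g).
Proof.
(* The determinant is the top left entry of A *m \adj A. *)
have := mul_mx_adj (mx3 a b c d e f g h k).
by rewrite adj_mx3 mul_mx3 => /matrixP/(_ 0 0); rewrite !mxE /= mulr1n.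
Qed.

(** An identity between polynomials with integer coefficients in the 18 entries
    of [x] and [y]: no invertibility is needed. *)
Lemma tr_comm_mulE (x y : 'M[K]_3) :
  \tr (x *m y *m (\adj x *m \adj y)) * \tr (y *m x *m (\adj y *m \adj x)) =
  comm_form (\det x) (\det y)
    (\tr x) (\tr y) (\tr (x *m y)) (\tr (x *m \adj y))
    (\tr (\adj x)) (\tr (\adj y)) (\tr (\adj x *m \adj y))
    (\tr (\adj x *m y)).
Proof.
have [x0 [x1 [x2 [x3 [x4 [x5 [x6 [x7 [x8 ->]]]]]]]]] := mx3_eta x.
have [y0 [y1 [y2 [y3 [y4 [y5 [y6 [y7 [y8 ->]]]]]]]]] := mx3_eta y.
rewrite !adj_mx3 !mul_mx3 !tr_mx3 !det_mx3 /comm_form.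
ring.
Qed.

End Matrix3.

(** * The identity on the invariant ring *)

Section Evaluation.
Variables (R : realType) (g : SL3pair R).

(** Evaluation of an invariant function at the pair [g], a ring morphism. *)
Definition eval_at (F : invring R) : R[i] := F g.

Fact eval_at_is_zmod_morphism : zmod_morphism eval_at.
Proof. by []. Qed.

Fact eval_at_is_monoid_morphism : monoid_morphism eval_at.
Proof. by []. Qed.

HB.instance Definition _ :=
  GRing.isZmodMorphism.Build (invring R) R[i] eval_at eval_at_is_zmod_morphism.
HB.instance Definition _ :=
  GRing.isMonoidMorphism.Build (invring R) R[i] eval_at
    eval_at_is_monoid_morphism.

End Evaluation.

Lemma invmx_SL3 (R : realType) (x : SL3 R) : invmx (slmx x) = \adj (slmx x).
Proof. by rewrite /invmx unitmx_SL3 det_SL3 invr1 scale1r. Qed.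

(** The relation in the invariant ring: it holds at each pair [g] by
    [tr_comm_mulE], the determinants being 1. *)
Lemma comm_form_trace_word (R : realType) :
  let tr := trace_word R in
  comm_form 1 1 (tr [:: X1]) (tr [:: X2]) (tr [:: X1; X2]) (tr [:: X1; X2V])
    (tr [:: X1V]) (tr [:: X2V]) (tr [:: X1V; X2V]) (tr [:: X1V; X2]) =
  tr [:: X1; X2; X1V; X2V] * tr [:: X2; X1; X2V; X1V].
Proof.
move=> tr; apply/val_inj/funext => g.
pose f : {rmorphism invring R -> R[i]} := eval_at g.
have trE w : f (tr w) = \tr (slmx (eval_word g w)) by [].
apply: etrans (rmorph_comm_form f _ _ _ _ _ _ _ _ _ _) _.
apply: etrans (esym (rmorphM f _ _)).
rewrite !rmorph1 !trE /= !mulmx1 !invmx_SL3 !mulmxA.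
have := tr_comm_mulE (slmx g.1) (slmx g.2).
by rewrite !det_SL3 !mulmxA => ->.
Qed.

Theorem lemma3p4p2 (R : realType) :
  (exists Q : polyR R, Pi R (Q%:MP - t5 R * tm5 R) = 0) /\
  (let t1 := t1 R in let t2 := t2 R in let t3 := t3 R in let t4 := t4 R in
   let tm1 := tm1 R in let tm2 := tm2 R in let tm3 := tm3 R in let tm4 := tm4 R in
   let Q : polyR R :=
      9 - 6 * t1 * tm1 - 6 * t2 * tm2 - 6 * t3 * tm3 - 6 * t4 * tm4 + t1 ^+ 3
      + t2 ^+ 3 + t3 ^+ 3 + t4 ^+ 3 + tm1 ^+ 3 + tm2 ^+ 3 + tm3 ^+ 3 + tm4 ^+ 3
      - 3 * tm4 * tm3 * tm1 - 3 * t4 * t3 * t1 - 3 * tm4 * t2 * t3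
      - 3 * t4 * tm2 * tm3 + 3 * tm4 * tm2 * t1 + 3 * t4 * t2 * tm1
      + 3 * t1 * t2 * tm3 + 3 * tm1 * tm2 * t3 + tm2 * tm1 * t2 * t1
      + tm3 * tm2 * t3 * t2 + tm4 * tm1 * t4 * t1 + tm4 * tm2 * t4 * t2
      + tm3 * tm1 * t3 * t1 + tm3 * tm4 * t3 * t4 + tm4 ^+ 2 * tm3 * tm2
      + t4 ^+ 2 * t3 * t2 + tm1 ^+ 2 * tm2 * tm4 + t1 ^+ 2 * t2 * t4
      + t1 * tm2 ^+ 2 * tm3 + tm1 * t2 ^+ 2 * t3 + tm4 * tm3 * t1 ^+ 2
      + t4 * t3 * tm1 ^+ 2 + tm4 * t2 * tm3 ^+ 2 + t4 * tm2 * t3 ^+ 2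
      + tm1 ^+ 2 * tm3 * t2 + t1 ^+ 2 * t3 * tm2 + tm4 * t1 * t2 ^+ 2
      + t4 * tm1 * tm2 ^+ 2 + tm4 * t3 * tm2 ^+ 2 + t4 * tm3 * t2 ^+ 2
      + t1 * t3 * tm4 ^+ 2 + tm1 * tm3 * t4 ^+ 2 + tm1 * tm4 * t3 ^+ 2
      + t1 * t4 * tm3 ^+ 2 - 2 * tm3 ^+ 2 * tm2 * tm1 - 2 * t3 ^+ 2 * t2 * t1
      - 2 * tm4 ^+ 2 * tm1 * t2 - 2 * t4 ^+ 2 * t1 * tm2
      + tm1 ^+ 2 * tm2 ^+ 2 * tm3 + t1 ^+ 2 * t2 ^+ 2 * t3
      + tm4 * tm1 ^+ 2 * t2 ^+ 2 + t4 * t1 ^+ 2 * tm2 ^+ 2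
      - tm4 * tm2 ^+ 2 * t2 * t1 - t4 * t2 ^+ 2 * tm2 * tm1
      - tm3 * t1 ^+ 2 * tm1 * t2 - t3 * tm1 ^+ 2 * t1 * tm2
      - tm3 * t2 ^+ 2 * tm2 * t1 - t3 * tm2 ^+ 2 * t2 * tm1
      - tm4 * tm2 * tm1 * t1 ^+ 2 - t4 * t2 * t1 * tm1 ^+ 2 - tm1 * tm2 ^+ 3 * t1
      - tm1 * t2 ^+ 3 * t1 - tm1 ^+ 3 * tm2 * t2 - t1 ^+ 3 * tm2 * t2
      - tm4 * tm3 * tm2 * tm1 * t2 - t4 * t3 * t2 * t1 * tm2
      - tm1 * t1 * t2 * tm4 * t3 - tm1 * t1 * tm2 * t4 * tm3
      + tm2 * tm1 ^+ 2 * t1 ^+ 2 * t2 + tm1 * tm2 ^+ 2 * t2 ^+ 2 * t1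
   in Pi R (Q%:MP - t5 R * tm5 R) = 0).
Proof.
(* With determinants 1, the form is the explicit polynomial of the statement. *)
suff Pi_comm : Pi R ((comm_form 1 1 (t1 R) (t2 R) (t3 R) (t4 R)
    (tm1 R) (tm2 R) (tm3 R) (tm4 R))%:MP - t5 R * tm5 R) = 0.
  split; first by eexists; exact: Pi_comm.
  move=> s1 s2 s3 s4 sm1 sm2 sm3 sm4 Q.
  have -> : Q = comm_form 1 1 s1 s2 s3 s4 sm1 sm2 sm3 sm4.
    rewrite {}/Q /comm_form.
    (* The identity holds for arbitrary values of the indeterminates. *)
    move: s1 s2 s3 s4 sm1 sm2 sm3 sm4 => *.
    ring.
  exact: Pi_comm.
rewrite rmorphB rmorphM; apply/eqP; rewrite subr_eq0; apply/eqP.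
(* [Pi] is [PiR] on constants, and sends each indeterminate to its trace. *)
have PiC q : Pi R q%:MP = PiR R q by rewrite /= mmapC.
have PiX k : Pi R 'X_k = Pi5_val R k by rewrite /= mmapX mmap1U.
have PiRX k : PiR R 'X_k = PiR_val R k by rewrite /= mmapX mmap1U.
rewrite PiC !PiX rmorph_comm_form !PiRX !rmorph1.
exact: comm_form_trace_word.
Qed.
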